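(* Let $G=(V,E)$ be a finite connected simple graph, let $\mathbf{U}$ be a universal adjacency matrix of $G$, let $\lambda\in\mathrm{spec}(\mathbf{U})$ be an eigenvalue of $\mathbf{U}$, and let $0\le i\le D_\lambda$. Let $\Pi$ be the set of orbits of $\mathrm{Aut}(G)$ acting on $V$. Then $V_{\lambda,i}$ is the disjoint union of a collection of orbits $\{\pi_1,\dots,\pi_{s_i}\}\subseteq\Pi$.
   Context: Graphs are finite, undirected, connected, without loops or multiple edges, with vertex set $V=\{v_1,\dots,v_n\}$. Let $\mathbf{A}$ be the adjacency matrix, $\mathbf{D}$ the diagonal matrix of vertex degrees, $\mathbf{I}$ the identity and $\mathbf{J}$ the all-ones matrix, all $n\times n$. A universal adjacency matrix of $G$ is a matrix $\mathbf{U}=\gamma_A\mathbf{A}+\gamma_D\mathbf{D}+\gamma_I\mathbf{I}+\gamma_J\mathbf{J}$ with real scalars $\gamma_A\neq 0,\gamma_D,\gamma_I,\gamma_J$. For an eigenvalue $\lambda$ of $\mathbf{U}$, a vertex $v_i$ is a $\lambda$-core vertex if there is an eigenvector $\mathbf{x}$ with $\mathbf{U}\mathbf{x}=\lambda\mathbf{x}$ whose $i$-th entry is non-zero. $CV_\lambda$ denotes the set of $\lambda$-core vertices. With $d(u,v)$ the length of a shortest path between $u$ and $v$, define $d_\lambda(v)=\min\{d(v,u): u\in CV_\lambda\}$, $D_\lambda=\max\{d_\lambda(v): v\in V\}$, and $V_{\lambda,i}=\{v\in V: d_\lambda(v)=i\}$ for $0\le i\le D_\lambda$; in particular $V_{\lambda,0}=CV_\lambda$.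 $\mathrm{Aut}(G)$ is the group of adjacency-preserving permutations of $V$ (graph automorphisms); the orbit of $v\in V$ is $\{\sigma(v):\sigma\in\mathrm{Aut}(G)\}$. *)

(* Defs.v *)
From HB Require Import structures.
From mathcomp Require Import all_boot all_order all_algebra all_fingroup.
From mathcomp Require Import boolp reals.
Set Implicit Arguments.
Unset Strict Implicit.
Unset Printing Implicit Defensive.
Import GRing.Theory.
Local Open Scope ring_scope.

(* A graph on the vertex set 'I_n is given by its adjacency relation [e];
   simplicity means that [e] is symmetric and irreflexive. *)

Section Matrices.
Variables (R : realType) (n : nat).
Implicit Types (e : rel 'I_n) (U : 'M[R]_n) (lambda : R).

Definition adj_mx e : 'M[R]_n := \matrix_(i, j) (e i j)%:R.

Definition deg_mx e : 'M[R]_n := diag_mx (\row_i #|[set j | e i j]|%:R).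

Definition universal_adj_mx e U : Prop :=
  exists gA gD gI gJ : R,
    gA != 0 /\
    U = gA *: adj_mx e + gD *: deg_mx e + gI *: 1%:M + gJ *: const_mx 1.

(* The existential over real vectors is turned into a boolean by classical
   logic. A vector with a non-zero entry is non-zero, hence an eigenvector. *)
Definition core_vertices U lambda : {set 'I_n} :=
  [set i | `[< exists x : 'cV[R]_n, U *m x = lambda *: x /\ x i 0 != 0 >]].

End Matrices.

Section Distances.
Variable n : nat.
Implicit Type e : rel 'I_n.

Definition has_path_of_length e (u v : 'I_n) (k : nat) : bool :=
  [exists p : k.-tuple 'I_n,
    [&& path e u p, uniq (u :: p) & last u p == v]].

(* A path has at most n - 1 edges, so the search is exhaustive; the value is n
   exactly when no path joins u and v. *)
Definition gdist e (u v : 'I_n) : nat :=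
  find (has_path_of_length e u v) (iota 0 n).

End Distances.

Section CoreDistances.
Variables (R : realType) (n : nat) (e : rel 'I_n) (U : 'M[R]_n) (lambda : R).

(* Distances never exceed n, so the default value n of the minimum is harmless
   as soon as there is a core vertex, i.e. when lambda is an eigenvalue. *)
Definition core_dist (v : 'I_n) : nat :=
  \big[minn/n]_(u in core_vertices U lambda) gdist e v u.

Definition core_depth : nat := \max_(v < n) core_dist v.

Definition core_layer (i : nat) : {set 'I_n} := [set v | core_dist v == i].

End CoreDistances.

Section Automorphisms.
Variables (n : nat) (e : rel 'I_n).

Definition graph_aut : {set 'S_n} :=
  [set s : 'S_n | [forall u, forall v, e (s u) (s v) == e u v]].

Lemma graph_aut_group_set : group_set graph_aut.
Proof.
apply/group_setP; split=> [|s t].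
  by rewrite inE; apply/'forall_forallP=> u v; rewrite !perm1.
rewrite !inE => /'forall_forallP hs /'forall_forallP ht.
by apply/'forall_forallP=> u v; rewrite !permM (eqP (ht _ _)) (eqP (hs _ _)).
Qed.

Canonical graph_aut_group := Group graph_aut_group_set.

Definition aut_orbits : {set {set 'I_n}} :=
  [set orbit 'P graph_aut v | v : 'I_n].

End Automorphisms.

(* Main.v *)
Require Import Defs.
From HB Require Import structures.
From mathcomp Require Import all_boot all_order all_algebra all_fingroup.
From mathcomp Require Import boolp reals.
Set Implicit Arguments.
Unset Strict Implicit.
Unset Printing Implicit Defensive.
Local Open Scope ring_scope.

(* An automorphism s commutes with A, D, I and J, hence with U, so composing
   with s preserves the lambda-eigenspace; thus s preserves the set of core
   vertices. As s also preserves distances, it preserves the distance to the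
   core, so every layer is stable under the automorphism group and is therefore
   partitioned by orbits. *)

(* [minn] has no neutral element in [nat], hence only a semigroup law; this is
   what reindexing the minimum in [core_dist] requires. *)
HB.instance Definition _ := SemiGroup.isComLaw.Build nat minn minnA minnC.

Section GraphAut.
Variables (n : nat) (e : rel 'I_n).

Lemma graph_autP (s : 'S_n) :
  reflect (forall u v, e (s u) (s v) = e u v) (s \in graph_aut e).
Proof.
rewrite inE; apply: (iffP forallP) => [h u v|h u]; first exact/eqP/(forallP (h u)).
by apply/forallP=> v; rewrite h.
Qed.

(** The image of a path under [s] is a path of the same length, without repetition since [s] is
    injective. *)
Lemma has_path_of_length_aut (s : 'S_n) u v k : s \in graph_aut e ->
  has_path_of_length e u v k -> has_path_of_length e (s u) (s v) k.
Proof.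
move=> /graph_autP h /existsP[p /and3P[pe pu /eqP <-]].
apply/existsP; exists (map_tuple s p); apply/and3P; split=> /=.
- by rewrite path_map; apply: sub_path pe => x y /=; rewrite h.
- by move: pu; rewrite -(map_inj_uniq (@perm_inj _ s)).
- by rewrite last_map.
Qed.

Lemma gdist_aut (s : 'S_n) u v :
  s \in graph_aut e -> gdist e (s u) (s v) = gdist e u v.
Proof.
move=> h; apply: eq_find => k; apply/idP/idP; last exact: has_path_of_length_aut.
(* The inverse automorphism carries a path from [s u] to [s v] back to one from [u] to [v]. *)
move/(has_path_of_length_aut (groupVr (G := graph_aut_group e) h)).
by rewrite !permK.
Qed.

Variables (R : realType) (U : 'M[R]_n) (lambda : R).
Hypothesis U_univ : universal_adj_mx e U.

(** Entrywise form of the commutation of [U] with the permutation matrix of [s]. *)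
Lemma universal_adj_mx_aut (s : 'S_n) i j :
  s \in graph_aut e -> U (s i) (s j) = U i j.
Proof.
move=> /graph_autP h; have [gA [gD [gI [gJ [_ ->]]]]] := U_univ.
(* [s] maps the neighbourhood of [i] bijectively onto that of [s i]. *)
have deg : #|[set k | e (s i) k]| = #|[set k | e i k]|.
  rewrite -(card_imset [set k | e i k] (@perm_inj _ s)); apply: eq_card => k.
  by rewrite -[k](permKV s) mem_imset ?inE ?h //; apply: perm_inj.
by rewrite !mxE h deg (inj_eq perm_inj).
Qed.

Lemma core_vertices_aut (s : 'S_n) v : s \in graph_aut e ->
  (s v \in core_vertices U lambda) = (v \in core_vertices U lambda).
Proof.
have core_pre t w : t \in graph_aut e ->
    t w \in core_vertices U lambda -> w \in core_vertices U lambda.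
  move=> h; rewrite !inE => /asboolP[x [Ux xw]].
  (* The vector with entries [x (t i)] has at [w] the non-zero entry of [x] at [t w]; row [i] of its
     eigenvalue equation is row [t i] of that of [x], with the sum reindexed along [t]. *)
  apply/asboolP; exists (row_perm t x); split; last by rewrite mxE.
  apply/colP=> i; have /colP/(_ (t i)) := Ux; rewrite !mxE => <-.
  rewrite [RHS](reindex_inj (@perm_inj _ t)); apply: eq_bigr => k _.
  by rewrite mxE universal_adj_mx_aut.
move=> h; apply/idP/idP; first exact: core_pre.
by rewrite -{1}[v](permK s); apply/core_pre/(groupVr (G := graph_aut_group e)).
Qed.

Lemma core_dist_aut (s : 'S_n) v :
  s \in graph_aut e -> core_dist e U lambda (s v) = core_dist e U lambda v.
Proof.
move=> h; rewrite /core_dist (reindex_inj (@perm_inj _ s)).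
by apply: eq_big => u; rewrite ?core_vertices_aut // => _; rewrite gdist_aut.
Qed.

Lemma core_layer_acts i :
  [acts graph_aut e, on core_layer e U lambda i | 'P].
Proof.
by apply/actsP=> s h v; rewrite !inE /= apermE core_dist_aut.
Qed.

End GraphAut.

Theorem theorem2p6 (R : realType) (n : nat) (e : rel 'I_n)
    (e_sym : symmetric e) (e_irr : irreflexive e)
    (e_conn : forall u v : 'I_n, connect e u v)
    (U : 'M[R]_n) (U_univ : universal_adj_mx e U)
    (lambda : R) (lambda_eig : eigenvalue U lambda)
    (i : nat) (le_i_D : (i <= core_depth e U lambda)%N) :
  exists P : {set {set 'I_n}},
    [/\ P \subset aut_orbits e,
        trivIset P
      & cover P = core_layer e U lambda i].
Proof.
(* Take the orbits of the vertices of the layer: they partition it because the group acts on it. *)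
exists (orbit 'P (graph_aut e) @: core_layer e U lambda i).
have /and3P[/eqP cov triv _] :=
  orbit_partition (G := graph_aut_group e) (core_layer_acts lambda U_univ i).
by split=> //; apply/imsetS/subsetP.
Qed.
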